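(* If $I$ and $J$ are Morita equivalent idempotent rings, then $V(I)\cong V(J)$ (as monoids).
   Context: Rings are associative and not necessarily unital. A ring $I$ is idempotent if $I^2=I$. For a ring $I$, the category $I\text{-}\mathbf{Mod}$ has as objects those left $I$-modules $M$ which are full ($IM=M$) and nondegenerate ($Ix=0$ implies $x=0$, for $x\in M$), and as morphisms all module homomorphisms between such modules. Rings $I$ and $J$ are Morita equivalent if the categories $I\text{-}\mathbf{Mod}$ and $J\text{-}\mathbf{Mod}$ are equivalent. For a ring $I$, let $M_\infty(I)=\bigcup_{n\ge1}M_n(I)$, where $a\in M_n(I)$ is identified with $a\oplus0\in M_{n+1}(I)$ and $\oplus$ denotes block-diagonal sum. Idempotents $e,f\in M_\infty(I)$ are equivalent if there exist $a,b\in M_\infty(I)$ with $ab=e$ and $ba=f$. $V(I)$ is the set of equivalence classes $[e]$ of idempotents of $M_\infty(I)$, an abelian monoid under $[e]+[f]=[e\oplus f]$. (Equivalently, $V(I)$ is the monoid of isomorphism classes of finitely generated projective left $R$-modules $P$ with $P=IP$, under direct sum, where $R$ is any unital ring containing $I$ as a two-sided ideal.) *)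

(* Defs.v *)
From HB Require Import structures.
From mathcomp Require Import all_boot all_order all_algebra.
From mathcomp Require Import boolp.

Set Implicit Arguments.
Unset Strict Implicit.
Unset Printing Implicit Defensive.

Import GRing.Theory.
Local Open Scope ring_scope.
Local Open Scope quotient_scope.

Reserved Notation "a ** b" (at level 40, left associativity).
Reserved Notation "a **: x" (at level 40, left associativity).
Reserved Notation "A **m B" (at level 40, left associativity).

HB.mixin Record Zmodule_isRng R of GRing.Zmodule R := {
  rmul : R -> R -> R;
  rmulA : associative rmul;
  rmulDl : left_distributive rmul +%R;
  rmulDr : right_distributive rmul +%R
}.

#[short(type="rngType")]
HB.structure Definition Rng := {R of GRing.Zmodule R & Zmodule_isRng R}.

Notation "a ** b" := (rmul a b) : ring_scope.

(* I^2 is the additive subgroup generated by the products, so I^2 = I says    *)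
(* that every element is a finite sum of products.                            *)
Definition idempotent_rng (I : rngType) : Prop :=
  forall x : I, exists s : seq (I * I), x = \sum_(p <- s) p.1 ** p.2.

HB.mixin Record Zmodule_isRngModule (I : rngType) M of GRing.Zmodule M := {
  act : I -> M -> M;
  actA : forall (a b : I) (x : M), act a (act b x) = act (a ** b) x;
  actDl : forall (a b : I) (x : M), act (a + b) x = act a x + act b x;
  actDr : forall (a : I) (x y : M), act a (x + y) = act a x + act a y
}.

#[short(type="rngModType")]
HB.structure Definition RngModule (I : rngType) :=
  {M of GRing.Zmodule M & Zmodule_isRngModule I M}.

Notation "a **: x" := (act a x) : ring_scope.

(* IM = M, where IM is the additive subgroup generated by the a **: x.        *)
Definition full_module (I : rngType) (M : rngModType I) : Prop :=
  forall x : M, exists s : seq (I * M), x = \sum_(p <- s) p.1 **: p.2.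

Definition nondegenerate_module (I : rngType) (M : rngModType I) : Prop :=
  forall x : M, (forall a : I, a **: x = 0) -> x = 0.

Record modHom (I : rngType) (M N : rngModType I) := ModHom {
  modHom_fun :> {additive M -> N};
  modHomZ : forall (a : I) (x : M), modHom_fun (a **: x) = a **: modHom_fun x
}.

Lemma modHom_ext (I : rngType) (M N : rngModType I) (f g : modHom M N) :
  f =1 g -> f = g.
Proof.
case: f g => [[f [[[f0 fD]]]] fZ] [[g [[[g0 gD]]]] gZ] /= fg.
move: f0 fD fZ; have -> : f = g by apply: funext.
move=> f0 fD fZ; rewrite (Prop_irrelevance f0 g0) (Prop_irrelevance fD gD) in fZ *.
by rewrite (Prop_irrelevance fZ gZ).
Qed.

Definition modHom_id (I : rngType) (M : rngModType I) : modHom M M :=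
  @ModHom I M M idfun (fun a x => erefl).

Lemma modHom_compZ (I : rngType) (M N P : rngModType I)
    (g : modHom N P) (f : modHom M N) (a : I) (x : M) :
  (g \o f) (a **: x) = a **: (g \o f) x.
Proof. by rewrite /= !modHomZ. Qed.

Definition modHom_comp (I : rngType) (M N P : rngModType I)
    (g : modHom N P) (f : modHom M N) : modHom M P :=
  @ModHom I M P (g \o f) (modHom_compZ g f).

Lemma modHom_idl (I : rngType) (M N : rngModType I) (f : modHom M N) :
  modHom_comp (modHom_id N) f = f.
Proof. exact: modHom_ext. Qed.

Lemma modHom_idr (I : rngType) (M N : rngModType I) (f : modHom M N) :
  modHom_comp f (modHom_id M) = f.
Proof. exact: modHom_ext. Qed.

Lemma modHom_compA (I : rngType) (M N P Q : rngModType I)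
    (h : modHom P Q) (g : modHom N P) (f : modHom M N) :
  modHom_comp h (modHom_comp g f) = modHom_comp (modHom_comp h g) f.
Proof. exact: modHom_ext. Qed.

Record category := Category {
  obj :> Type;
  hom : obj -> obj -> Type;
  idm : forall X, hom X X;
  comp : forall X Y Z, hom Y Z -> hom X Y -> hom X Z;
  comp_idl : forall X Y (f : hom X Y), comp (idm Y) f = f;
  comp_idr : forall X Y (f : hom X Y), comp f (idm X) = f;
  compA : forall X Y Z W (h : hom Z W) (g : hom Y Z) (f : hom X Y),
    comp h (comp g f) = comp (comp h g) f
}.

Arguments hom {c}.
Arguments idm {c}.
Arguments comp {c X Y Z}.

Record functor (C D : category) := Functor {
  fobj :> C -> D;
  fmor : forall X Y : C, hom X Y -> hom (fobj X) (fobj Y);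
  fmor_id : forall X : C, fmor (idm X) = idm (fobj X);
  fmor_comp : forall (X Y Z : C) (g : hom Y Z) (f : hom X Y),
    fmor (comp g f) = comp (fmor g) (fmor f)
}.

Arguments fmor {C D} _ {X Y}.

Definition functor_id (C : category) : functor C C :=
  @Functor C C id (fun X Y f => f) (fun X => erefl) (fun X Y Z g f => erefl).

Section FunctorComp.
Variables (C D E : category) (G : functor D E) (F : functor C D).

Lemma functor_comp_id (X : C) : fmor G (fmor F (idm X)) = idm (G (F X)).
Proof. by rewrite !fmor_id. Qed.

Lemma functor_comp_comp (X Y Z : C) (g : hom Y Z) (f : hom X Y) :
  fmor G (fmor F (comp g f)) = comp (fmor G (fmor F g)) (fmor G (fmor F f)).
Proof. by rewrite !fmor_comp. Qed.

Definition functor_comp : functor C E :=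
  @Functor C E (fun X => G (F X)) (fun X Y f => fmor G (fmor F f))
    functor_comp_id functor_comp_comp.

End FunctorComp.

Definition naturally_isomorphic (C D : category) (F G : functor C D) : Prop :=
  exists (eta : forall X : C, hom (F X) (G X))
         (eps : forall X : C, hom (G X) (F X)),
    [/\ forall (X Y : C) (f : hom X Y),
          comp (eta Y) (fmor F f) = comp (fmor G f) (eta X),
        forall X : C, comp (eps X) (eta X) = idm (F X)
      & forall X : C, comp (eta X) (eps X) = idm (G X)].

(* The functors need not be additive.                                         *)
Definition equivalent_categories (C D : category) : Prop :=
  exists (F : functor C D) (G : functor D C),
    naturally_isomorphic (functor_comp G F) (functor_id C) /\
    naturally_isomorphic (functor_comp F G) (functor_id D).

Record fullNondegMod (I : rngType) := FullNondegMod {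
  fnm_mod :> rngModType I;
  fnm_full : full_module fnm_mod;
  fnm_nondeg : nondegenerate_module fnm_mod
}.

Definition ModCat (I : rngType) : category :=
  @Category (fullNondegMod I) (fun M N => modHom M N)
    (fun M => modHom_id M) (fun M N P g f => modHom_comp g f)
    (fun M N f => modHom_idl f) (fun M N f => modHom_idr f)
    (fun M N P Q h g f => modHom_compA h g f).

Definition morita_equivalent (I J : rngType) : Prop :=
  equivalent_categories (ModCat I) (ModCat J).

(* The matrix product *m of the library needs a semiring with unit.           *)
Definition rmulmx (I : rngType) (m n p : nat)
    (A : 'M[I]_(m, n)) (B : 'M[I]_(n, p)) : 'M[I]_(m, p) :=
  \matrix_(i, j) \sum_k A i k ** B k j.

Notation "A **m B" := (rmulmx A B) : ring_scope.

Section RngTheory.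
Variable I : rngType.
Implicit Types a b c : I.

Lemma rmul0l b : 0 ** b = 0.
Proof. by apply: (addrI (0 ** b)); rewrite -rmulDl !addr0. Qed.

Lemma rmul0r a : a ** 0 = 0.
Proof. by apply: (addrI (a ** 0)); rewrite -rmulDr !addr0. Qed.

Lemma rmul_suml (T : Type) (r : seq T) (P : pred T) (F : T -> I) b :
  (\sum_(i <- r | P i) F i) ** b = \sum_(i <- r | P i) F i ** b.
Proof.
by apply: (big_morph (fun a => a ** b)) => [x y|]; rewrite ?rmulDl ?rmul0l.
Qed.

Lemma rmul_sumr (T : Type) (r : seq T) (P : pred T) (F : T -> I) a :
  a ** (\sum_(i <- r | P i) F i) = \sum_(i <- r | P i) a ** F i.
Proof. by apply: (big_morph (rmul a)) => [x y|]; rewrite ?rmulDr ?rmul0r. Qed.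

Lemma rmulmxA m n p q (A : 'M[I]_(m, n)) (B : 'M[I]_(n, p)) (C : 'M[I]_(p, q)) :
  A **m (B **m C) = A **m B **m C.
Proof.
apply/matrixP=> i j; rewrite !mxE.
under eq_bigr => k _ do rewrite mxE rmul_sumr.
rewrite exchange_big /=; apply: eq_bigr => k _.
by rewrite mxE rmul_suml; apply: eq_bigr => l _; rewrite rmulA.
Qed.

Lemma rmul0mx m n p (B : 'M[I]_(n, p)) : (0 : 'M[I]_(m, n)) **m B = 0.
Proof. by apply/matrixP=> i j; rewrite !mxE big1 // => k _; rewrite mxE rmul0l. Qed.

Lemma rmulmx0 m n p (A : 'M[I]_(m, n)) : A **m (0 : 'M[I]_(n, p)) = 0.
Proof. by apply/matrixP=> i j; rewrite !mxE big1 // => k _; rewrite mxE rmul0r. Qed.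

Lemma rmulmx_block m1 m2 n1 n2 p1 p2
    (Aul : 'M[I]_(m1, n1)) (Aur : 'M[I]_(m1, n2))
    (Adl : 'M[I]_(m2, n1)) (Adr : 'M[I]_(m2, n2))
    (Bul : 'M[I]_(n1, p1)) (Bur : 'M[I]_(n1, p2))
    (Bdl : 'M[I]_(n2, p1)) (Bdr : 'M[I]_(n2, p2)) :
  block_mx Aul Aur Adl Adr **m block_mx Bul Bur Bdl Bdr =
  block_mx (Aul **m Bul + Aur **m Bdl) (Aul **m Bur + Aur **m Bdr)
           (Adl **m Bul + Adr **m Bdl) (Adl **m Bur + Adr **m Bdr).
Proof.
apply/matrixP=> i j; rewrite [LHS]mxE big_split_ord /=.
case: (split_ordP i) => i' ->; case: (split_ordP j) => j' ->;
  rewrite ?(block_mxEul, block_mxEur, block_mxEdl, block_mxEdr) [RHS]mxE;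
  congr (_ + _); rewrite [RHS]mxE; apply: eq_bigr => k _;
  by rewrite ?(block_mxEul, block_mxEur, block_mxEdl, block_mxEdr).
Qed.

End RngTheory.

(* M_oo(I): an element is given by a matrix of some size n, two matrices      *)
(* being identified when they agree after extension by zero (minf_eq). The    *)
(* size n = 0 is allowed; it only provides another name for the zero matrix.  *)

Definition minf (I : rngType) := {n : nat & 'M[I]_n}.

Definition Minf (I : rngType) (n : nat) (A : 'M[I]_n) : minf I :=
  existT (fun n => 'M[I]_n) n A.

(* Entries, extended by zero.                                                 *)
Definition ent (I : rngType) (m n : nat) (A : 'M[I]_(m, n)) (i j : nat) : I :=
  if insub i is Some i' then if insub j is Some j' then A i' j' else 0 else 0.

(* Truncation, or extension by zero, to size m x n.                           *)
Definition resize (I : rngType) (m' n' m n : nat) (A : 'M[I]_(m', n')) :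
  'M[I]_(m, n) := \matrix_(i, j) ent A i j.

Arguments resize {I m' n'} m n A.

Definition minf_eq (I : rngType) (a b : minf I) : Prop :=
  forall i j : nat, ent (tagged a) i j = ent (tagged b) i j.

Definition minf_mul (I : rngType) (a b : minf I) : minf I :=
  let n := maxn (tag a) (tag b) in
  Minf (resize n n (tagged a) **m resize n n (tagged b)).

(* Block-diagonal sum; it depends on the sizes, but its class in V(I) does    *)
(* not (see V_addE).                                                          *)
Definition minf_dsum (I : rngType) (a b : minf I) : minf I :=
  Minf (block_mx (tagged a) 0 0 (tagged b)).

Definition idempotent_mx (I : rngType) :=
  {e : minf I | `[< minf_eq (minf_mul e e) e >]}.

Definition idem_equiv (I : rngType) (e f : minf I) : Prop :=
  exists a b : minf I, minf_eq (minf_mul a b) e /\ minf_eq (minf_mul b a) f.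

Section MinfTheory.
Variable I : rngType.
Implicit Types a b c e f g : minf I.

Lemma entE m n (A : 'M[I]_(m, n)) (i : 'I_m) (j : 'I_n) : ent A i j = A i j.
Proof. by rewrite /ent !valK. Qed.

Lemma ent_geq m n (A : 'M[I]_(m, n)) (i j : nat) :
  (m <= i)%N || (n <= j)%N -> ent A i j = 0.
Proof.
rewrite /ent; case: insubP => // i' lt_i _; rewrite leqNgt lt_i /=.
by case: insubP => // j' lt_j _; rewrite leqNgt lt_j.
Qed.

Lemma ent_resize m' n' m n (A : 'M[I]_(m', n')) (i j : nat) :
  ent (resize m n A) i j = if (i < m)%N && (j < n)%N then ent A i j else 0.
Proof.
case: ifP => [/andP[lt_i lt_j]|/negbT]; last first.
  by rewrite negb_and -!leqNgt => /ent_geq.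
by rewrite -[i]/(val (Ordinal lt_i)) -[j]/(val (Ordinal lt_j)) entE mxE.
Qed.

Lemma ent_resize_id m' n' m n (A : 'M[I]_(m', n')) :
  (m' <= m)%N -> (n' <= n)%N -> forall i j, ent (resize m n A) i j = ent A i j.
Proof.
move=> le_m le_n i j; rewrite ent_resize; case: ifP => // /negbT.
rewrite negb_and -!leqNgt => /orP[] h; rewrite ent_geq //.
  by rewrite (leq_trans le_m h).
by rewrite (leq_trans le_n h) orbT.
Qed.

Lemma resize_ext m' n' m'' n'' m n (A : 'M[I]_(m', n')) (B : 'M[I]_(m'', n'')) :
  ent A =2 ent B -> resize m n A = resize m n B.
Proof. by move=> AB; apply/matrixP=> i j; rewrite !mxE AB. Qed.

Lemma resize_id m n (A : 'M[I]_(m, n)) : resize m n A = A.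
Proof. by apply/matrixP=> i j; rewrite !mxE entE. Qed.

Lemma resize_resize m' n' p q m n (A : 'M[I]_(m', n')) :
  (m' <= p)%N -> (n' <= q)%N -> resize m n (resize p q A) = resize m n A.
Proof. by move=> hp hq; apply: resize_ext => i j; apply: ent_resize_id. Qed.

Lemma resize_mul m' n' p' m N p (A : 'M[I]_(m', n')) (B : 'M[I]_(n', p')) :
  (n' <= N)%N -> resize m p (A **m B) = resize m N A **m resize N p B.
Proof.
move=> le_N; apply/matrixP=> i j; rewrite !mxE.
under eq_bigr do rewrite !mxE.
pose F k := ent A i k ** ent B k j.
rewrite -(big_mkord xpredT F) (big_cat_nat _ le_N) //= [X in _ + X]big_nat_cond.
rewrite [X in _ + X]big1 => [|k /andP[/andP[hk _] _]]; last first.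
  by rewrite /F ent_geq ?hk ?orbT // rmul0l.
rewrite addr0 big_mkord /F.
have [lt_i|ge_i] := ltnP i m'; last first.
  rewrite ent_geq ?ge_i // big1 // => k _.
  by rewrite ent_geq ?ge_i // rmul0l.
have [lt_j|ge_j] := ltnP j p'; last first.
  rewrite ent_geq ?ge_j ?orbT // big1 // => k _.
  by rewrite [ent B _ _]ent_geq ?ge_j ?orbT // rmul0r.
rewrite -[nat_of_ord i]/(val (Ordinal lt_i)) -[nat_of_ord j]/(val (Ordinal lt_j)).
by rewrite entE mxE; apply: eq_bigr => k _; rewrite !entE.
Qed.

Lemma resize_minf_mul a b N : (tag a <= N)%N -> (tag b <= N)%N ->
  resize N N (tagged (minf_mul a b)) =
  resize N N (tagged a) **m resize N N (tagged b).
Proof.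
move=> ha hb; rewrite /minf_mul /= (@resize_mul _ _ _ _ N) ?geq_max ?ha //.
by rewrite !resize_resize ?leq_maxl ?leq_maxr.
Qed.

Lemma idempotent_mxP (e : idempotent_mx I) :
  tagged (val e) **m tagged (val e) = tagged (val e).
Proof.
have /asboolP h := valP e; have := resize_ext (tag (val e)) (tag (val e)) h.
by rewrite resize_minf_mul // !resize_id.
Qed.

Lemma idempotent_mxI e :
  tagged e **m tagged e = tagged e -> minf_eq (minf_mul e e) e.
Proof.
move=> ee i j.
by rewrite /minf_mul /= -resize_mul ?leq_maxl // ee ent_resize_id ?leq_maxl.
Qed.

(* The matrices a and b may be taken rectangular, of the sizes of e and f.    *)
Lemma idem_equivP e f :
  tagged e **m tagged e = tagged e -> tagged f **m tagged f = tagged f ->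
  idem_equiv e f <->
  exists (A : 'M[I]_(tag e, tag f)) (B : 'M[I]_(tag f, tag e)),
    A **m B = tagged e /\ B **m A = tagged f.
Proof.
case: e f => [n e] [m f] /= ee ff; split=> [[a [b []]]|[A [B [AB BA]]]].
- set N := maxn (maxn (tag a) (tag b)) (maxn n m).
  have [ha hb hn hm] : [/\ tag a <= N, tag b <= N, n <= N & m <= N]%N.
    by rewrite /N !leq_max !leqnn !orbT.
  move=> /(resize_ext N N) /=; rewrite resize_minf_mul //.
  set P := resize N N (tagged a); set Q := resize N N (tagged b) => PQ.
  move=> /(resize_ext N N) /=; rewrite resize_minf_mul // -/P -/Q => QP.
  exists (resize n N e **m P **m resize N m f).
  exists (resize m N f **m Q **m resize N n e).
  have eN : resize N n e **m resize n N e = P **m Q.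
    by rewrite -resize_mul // ee PQ.
  have fN : resize N m f **m resize m N f = Q **m P.
    by rewrite -resize_mul // ff QP.
  have mid k (p q r : nat) (X : 'M[I]_(p, N)) (Y : 'M[I]_(N, k))
    (Z : 'M[I]_(k, N)) (T : 'M[I]_(N, r)) (U : 'M[I]_(N, N))
    (W : 'M[I]_(N, N)) :
      X **m U **m Y **m (Z **m W **m T) = X **m (U **m (Y **m Z) **m W) **m T.
    by rewrite !rmulmxA.
  split; rewrite mid ?fN ?eN // -?rmulmxA.
    have -> : P **m (Q **m (P **m (Q **m resize N n e)))
            = resize N N e **m (resize N N e **m resize N n e).
      by rewrite -PQ !rmulmxA.
    by rewrite -!resize_mul // !ee resize_id.
  have -> : Q **m (P **m (Q **m (P **m resize N m f)))
          = resize N N f **m (resize N N f **m resize N m f).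
    by rewrite -QP !rmulmxA.
  by rewrite -!resize_mul // !ff resize_id.
- pose N := maxn n m.
  have [hn hm] : (n <= N)%N /\ (m <= N)%N by rewrite leq_maxl leq_maxr.
  exists (Minf (resize N N A)), (Minf (resize N N B)).
  split=> i j; rewrite /minf_mul /= maxnn !resize_id -resize_mul //.
    by rewrite AB ent_resize_id.
  by rewrite BA ent_resize_id.
Qed.

Lemma minf_eq_equiv e f : minf_eq (minf_mul e e) e -> minf_eq e f ->
  idem_equiv e f.
Proof. by move=> ee ef; exists e, e; split=> // i j; rewrite ee ef. Qed.

Lemma idem_equiv_sym e f : idem_equiv e f -> idem_equiv f e.
Proof. by case=> a [b [ab ba]]; exists b, a. Qed.

Lemma idem_equiv_trans (e f g : idempotent_mx I) :
  idem_equiv (val e) (val f) -> idem_equiv (val f) (val g) ->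
  idem_equiv (val e) (val g).
Proof.
have [ee ff gg] := And3 (idempotent_mxP e) (idempotent_mxP f) (idempotent_mxP g).
move=> /(idem_equivP ee ff)[A [B [AB BA]]] /(idem_equivP ff gg)[C [D [CD DC]]].
apply/(idem_equivP ee gg); exists (A **m C), (D **m B); split.
  by rewrite rmulmxA -(rmulmxA A C) CD -BA rmulmxA AB -rmulmxA AB ee.
by rewrite rmulmxA -(rmulmxA D B) BA -CD rmulmxA DC -rmulmxA DC gg.
Qed.

Lemma minf_dsum_idem (e f : idempotent_mx I) :
  `[< minf_eq (minf_mul (minf_dsum (val e) (val f)) (minf_dsum (val e) (val f)))
              (minf_dsum (val e) (val f)) >].
Proof.
apply/asboolP/idempotent_mxI; rewrite /minf_dsum /= rmulmx_block.
by rewrite !rmulmx0 !rmul0mx !idempotent_mxP !(addr0, add0r).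
Qed.

Lemma minf0_idem :
  `[< minf_eq (minf_mul (Minf (0 : 'M[I]_0)) (Minf (0 : 'M[I]_0)))
              (Minf (0 : 'M[I]_0)) >].
Proof. by apply/asboolP/idempotent_mxI; rewrite /= rmulmx0. Qed.

Lemma ent_dsum a b i j :
  ent (tagged (minf_dsum a b)) i j =
  if (i < tag a)%N then if (j < tag a)%N then ent (tagged a) i j else 0
  else if (j < tag a)%N then 0
  else ent (tagged b) (i - tag a) (j - tag a).
Proof.
case: a b => [n A] [m B] /=.
have [lt_i|ge_i] := ltnP i (n + m); last first.
  have le_i : (n <= i)%N by apply: leq_trans (leq_addr _ _) ge_i.
  rewrite ent_geq ?ge_i // ltnNge le_i /=; case: ifP => // _.
  by rewrite ent_geq // leq_subRL // ge_i.
have [lt_j|ge_j] := ltnP j (n + m); last first.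
  have le_j : (n <= j)%N by apply: leq_trans (leq_addr _ _) ge_j.
  rewrite ent_geq ?ge_j ?orbT // [(j < n)%N]ltnNge le_j /=; case: ifP => // _.
  by rewrite ent_geq // [X in _ || X]leq_subRL // ge_j orbT.
rewrite -[i]/(val (Ordinal lt_i)) -[j]/(val (Ordinal lt_j)) entE.
case: (split_ordP (Ordinal lt_i)) => i' ->;
case: (split_ordP (Ordinal lt_j)) => j' ->;
  rewrite ?(block_mxEul, block_mxEur, block_mxEdl, block_mxEdr) /= ?mxE;
  rewrite ?ltn_ord ?entE // ?ltnNge ?leq_addr //=.
by rewrite !addKn entE.
Qed.

End MinfTheory.

Section VMonoid.
Variable I : rngType.

Definition idem_dsum (e f : idempotent_mx I) : idempotent_mx I :=
  Sub (minf_dsum (val e) (val f)) (minf_dsum_idem e f).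

Definition idem0 : idempotent_mx I := Sub (Minf (0 : 'M[I]_0)) (minf0_idem I).

Definition idem_rel : rel (idempotent_mx I) :=
  fun e f => `[< idem_equiv (val e) (val f) >].

Lemma idem_rel_refl : reflexive idem_rel.
Proof. by move=> e; apply/asboolP/minf_eq_equiv => //; apply/asboolP/(valP e). Qed.

Lemma idem_rel_sym : symmetric idem_rel.
Proof.
by move=> e f; apply/idP/idP => /asboolP/idem_equiv_sym h; apply/asboolP.
Qed.

Lemma idem_rel_trans : transitive idem_rel.
Proof.
move=> f e g /asboolP ef /asboolP fg; apply/asboolP; exact: idem_equiv_trans ef fg.
Qed.

Canonical idem_equiv_rel :=
  EquivRel idem_rel idem_rel_refl idem_rel_sym idem_rel_trans.

Definition V := {eq_quot idem_equiv_rel}.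

HB.instance Definition _ := Choice.on V.
HB.instance Definition _ := EqQuotient.on V.

Definition Vclass (e : idempotent_mx I) : V := \pi_V e.

Lemma VclassP (e f : idempotent_mx I) :
  Vclass e = Vclass f <-> idem_equiv (val e) (val f).
Proof. by split=> [/eqmodP/asboolP|h]; last by apply/eqmodP/asboolP. Qed.

Lemma VclassK (x : V) : Vclass (repr x) = x.
Proof. exact: reprK. Qed.

Lemma Vclass_repr (e : idempotent_mx I) :
  idem_equiv (val (repr (Vclass e))) (val e).
Proof. by apply/VclassP; rewrite VclassK. Qed.

Definition V_add (x y : V) : V := Vclass (idem_dsum (repr x) (repr y)).
Definition V_zero : V := Vclass idem0.

Lemma idem_dsum_equiv (e e' f f' : idempotent_mx I) :
  idem_equiv (val e) (val e') -> idem_equiv (val f) (val f') ->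
  idem_equiv (val (idem_dsum e f)) (val (idem_dsum e' f')).
Proof.
move=> /(idem_equivP (idempotent_mxP e) (idempotent_mxP e'))[A [B [AB BA]]].
move=> /(idem_equivP (idempotent_mxP f) (idempotent_mxP f'))[C [D [CD DC]]].
apply/(idem_equivP (idempotent_mxP _) (idempotent_mxP _)).
exists (block_mx A 0 0 C), (block_mx B 0 0 D).
by rewrite !rmulmx_block !rmulmx0 !rmul0mx !(addr0, add0r) AB BA CD DC.
Qed.

Lemma V_addE (e f : idempotent_mx I) :
  V_add (Vclass e) (Vclass f) = Vclass (idem_dsum e f).
Proof. by apply/VclassP/idem_dsum_equiv; apply: Vclass_repr. Qed.

Lemma V_addA : associative V_add.
Proof.
move=> x y z; rewrite -(VclassK x) -(VclassK y) -(VclassK z) !V_addE.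
move: (repr x) (repr y) (repr z) => e f g.
apply/VclassP/minf_eq_equiv => [|i j]; first exact/asboolP/(valP (idem_dsum _ _)).
rewrite !ent_dsum /= !subnDA.
have lt_dsum k n m : (k < n + m)%N = (k < n)%N || (k - n < m)%N.
  by case: (ltnP k n) => h /=; [rewrite ltn_addr | rewrite ltn_subLR].
rewrite !lt_dsum.
by case: (i < _)%N; case: (j < _)%N => //=; do ?[case: ifP].
Qed.

Lemma V_addC : commutative V_add.
Proof.
move=> x y; rewrite -(VclassK x) -(VclassK y) !V_addE.
move: (repr x) (repr y) => e f; apply/VclassP.
apply/(idem_equivP (idempotent_mxP _) (idempotent_mxP _)).
exists (block_mx 0 (tagged (val e)) (tagged (val f)) 0).
exists (block_mx 0 (tagged (val f)) (tagged (val e)) 0).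
by rewrite !rmulmx_block !rmulmx0 !rmul0mx !(addr0, add0r) !idempotent_mxP.
Qed.

Lemma V_add0 : left_id V_zero V_add.
Proof.
move=> x; rewrite -(VclassK x) V_addE; move: (repr x) => e.
apply/VclassP/minf_eq_equiv => [|i j]; first exact/asboolP/(valP (idem_dsum _ _)).
by rewrite ent_dsum /= !subn0.
Qed.

HB.instance Definition _ := GRing.isNmodule.Build V V_addA V_addC V_add0.

End VMonoid.

(* Main.v *)
(** For an idempotent matrix [e] over [I], let [P_e] be [I^n e] modulo the
    elements killed by [I]; then [Hom(P_e, M) = e M^n] for every [M] in
    [I-Mod], and [P_e], [P_f] are isomorphic iff [e], [f] are equivalent. The
    [P_e] are, up to isomorphism, the projective objects that are compact in
    the sense that every jointly epimorphic family into them has a finite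
    jointly epimorphic subfamily, and [P_(e (+) f)] is a coproduct of [P_e] and
    [P_f]. All this is expressed by arrows and composition, hence is preserved
    by any equivalence of categories, additive or not. *)
From HB Require Import structures.
From mathcomp Require Import all_boot all_order all_algebra.
From mathcomp Require Import boolp.
(* Last, because the library also has a [hom] and a [comp]. *)
Require Import Defs.

Set Implicit Arguments.
Unset Strict Implicit.
Unset Printing Implicit Defensive.

Import GRing.Theory.
Local Open Scope ring_scope.
Local Open Scope quotient_scope.

(** * Modules over a ring without unit, and their quotients *)

Lemma acts0 (I : rngType) (M : rngModType I) (a : I) : a **: (0 : M) = 0.
Proof. by apply: (addrI (a **: 0)); rewrite -actDr !addr0. Qed.

Lemma act0s (I : rngType) (M : rngModType I) (x : M) : 0 **: x = 0.
Proof. by apply: (addrI (0 **: x)); rewrite -actDl !addr0. Qed.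

Lemma actN (I : rngType) (M : rngModType I) (a : I) (x : M) :
  a **: - x = - (a **: x).
Proof. by apply/eqP; rewrite -addr_eq0 -actDr addNr acts0. Qed.

Lemma act_sumr (I : rngType) (M : rngModType I) (a : I) (T : Type) (r : seq T)
    (P : pred T) (F : T -> M) :
  a **: (\sum_(i <- r | P i) F i) = \sum_(i <- r | P i) a **: F i.
Proof. by apply: (big_morph (act a)) => [x y|]; rewrite ?actDr ?acts0. Qed.

Lemma act_suml (I : rngType) (M : rngModType I) (x : M) (T : Type) (r : seq T)
    (P : pred T) (F : T -> I) :
  (\sum_(i <- r | P i) F i) **: x = \sum_(i <- r | P i) F i **: x.
Proof.
by apply: (big_morph (fun a => a **: x)) => [a b|]; rewrite ?actDl ?act0s.
Qed.

Lemma modHom_of (I : rngType) (M N : rngModType I) (f : M -> N) :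
  (forall x y, f (x + y) = f x + f y) ->
  (forall a x, f (a **: x) = a **: f x) -> exists g : modHom M N, g =1 f.
Proof.
move=> fD fZ.
have f0 : f 0 = 0 by apply: (addrI (f 0)); rewrite -fD !addr0.
pose F : {additive M -> N} :=
  HB.pack f (GRing.isNmodMorphism.Build M N f (conj f0 fD)).
by exists (@ModHom I M N F fZ).
Qed.

(** Compose [f] with a set-theoretic section of [p]: the kernel condition makes the result
    independent of the section, hence additive and linear. *)
Lemma modHom_factor (I : rngType) (M Q N : rngModType I) (p : modHom M Q)
    (f : modHom M N) :
  (forall y, exists x, y = p x) -> (forall x, p x = 0 -> f x = 0) ->
  exists g : modHom Q N, forall x, g (p x) = f x.
Proof.
move=> p_surj ker; pose s y := projT1 (cid (p_surj y)).
have sK y : p (s y) = y by rewrite /s; case: cid.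
have pf x y : p x = p y -> f x = f y.
  by move=> pxy; apply/eqP; rewrite -subr_eq0 -raddfB ker // raddfB pxy subrr.
have [x y|a x|g gE] := modHom_of (f := fun y => f (s y)).
- by rewrite -raddfD; apply: pf; rewrite raddfD /= !sK.
- by rewrite -modHomZ; apply: pf; rewrite modHomZ !sK.
by exists g => x; rewrite gE; apply: pf; rewrite sK.
Qed.

(* Saturation of [S] makes [M / S] nondegenerate. *)
Lemma quotient_module (I : rngType) (M : rngModType I) (S : M -> Prop) :
  full_module M -> S 0 -> (forall x y, S x -> S y -> S (x - y)) ->
  (forall a x, S x -> S (a **: x)) ->
  (forall x, (forall a, S (a **: x)) -> S x) ->
  exists (Q : fullNondegMod I) (p : modHom M Q),
    (forall y, exists x, y = p x) /\ (forall x, p x = 0 <-> S x).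
Proof.
move=> fullM S0 SB SZ sat.
pose s : {pred M} := fun x => `[< S x >].
have sP x : x \in s <-> S x by rewrite -topredE /= /s; split=> /asboolP.
have s_closed : zmod_closed s.
  by split=> [|x y /sP Sx /sP Sy]; apply/sP => //; apply: SB.
pose zs : zmodClosed M := HB.pack s (GRing.isZmodClosed.Build M s s_closed).
pose Q : zmodType := Quotient.quot zs.
pose p : M -> Q := \pi_(Quotient.quot zs).
have pP x y : p x = p y <-> S (x - y).
  rewrite -sP; split=> [/eqP|h]; last apply/eqP.
    by rewrite -[p x == _]/(_ == _ %[mod Quotient.quot zs]) -Quotient.idealrBE.
  by rewrite -[p x == _]/(_ == _ %[mod Quotient.quot zs]) -Quotient.idealrBE.
have pD x y : p (x + y) = p x + p y by rewrite /p raddfD.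
have pK (y : Q) : p (repr y) = y by rewrite /p reprK.
pose qact (a : I) (y : Q) : Q := p (a **: repr y).
have qactE a x : qact a (p x) = p (a **: x).
  by apply/pP; rewrite -actN -actDr; apply/SZ/pP; rewrite pK.
have qA a b y : qact a (qact b y) = qact (a ** b) y.
  by rewrite -(pK y) !qactE actA.
have qDl a b y : qact (a + b) y = qact a y + qact b y.
  by rewrite -(pK y) !qactE actDl pD.
have qDr a x y : qact a (x + y) = qact a x + qact a y.
  by rewrite -(pK x) -(pK y) -pD !qactE actDr pD.
pose QM : rngModType I :=
  HB.pack Q (Zmodule_isRngModule.Build I Q qA qDl qDr).
have [//||f fE] := @modHom_of I M QM p.
  by move=> a x; rewrite -qactE.
have p0 x : f x = 0 <-> S x.
  rewrite -[x in S x]subr0 -pP fE; split=> [->|->]; rewrite -fE raddf0 //.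
have surj (y : QM) : exists x, y = f x by exists (repr y); rewrite fE pK.
have fullQ : full_module QM.
  move=> y; have [x ->] := surj y; have [r ->] := fullM x.
  exists [seq (q.1, f q.2) | q <- r]; rewrite big_map raddf_sum /=.
  by apply: eq_bigr => q _; rewrite modHomZ.
have ndQ : nondegenerate_module QM.
  move=> y; have [x ->] := surj y => h; apply/p0/sat => a.
  by apply/p0; rewrite modHomZ h.
by exists (FullNondegMod fullQ ndQ), f.
Qed.

(** As I is generated by products, whatever I^2 kills is killed by I. Hence dividing once by the
    elements killed by I already gives a nondegenerate module. *)
Lemma idempotent_ann (I : rngType) (M : rngModType I) (x : M) :
  idempotent_rng I -> (forall a b : I, a **: (b **: x) = 0) ->
  forall a : I, a **: x = 0.
Proof.
move=> idI h a; have [s ->] := idI a; rewrite act_suml big1 // => q _.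
by rewrite -actA.
Qed.

Lemma ann_quotient (I : rngType) (M : rngModType I) :
  idempotent_rng I -> full_module M ->
  exists (Q : fullNondegMod I) (q : modHom M Q),
    (forall y, exists x, y = q x) /\
    (forall x, q x = 0 <-> forall a, a **: x = 0).
Proof.
move=> idI fullM; apply: quotient_module => //.
- by move=> a; rewrite acts0.
- by move=> x y hx hy a; rewrite actDr actN hx hy subrr.
- by move=> a x h b; rewrite h acts0.
- by move=> x h; apply: idempotent_ann.
Qed.

(** * The row modules I^n, and matrices acting on columns of module elements *)

Section RowModule.
Variables (I : rngType) (n : nat).

Definition row_act (a : I) (x : 'rV[I]_n) : 'rV[I]_n := map_mx (rmul a) x.

Fact row_actA a b x : row_act a (row_act b x) = row_act (a ** b) x.
Proof. by apply/matrixP=> i j; rewrite !mxE rmulA. Qed.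

Fact row_actDl a b x : row_act (a + b) x = row_act a x + row_act b x.
Proof. by apply/matrixP=> i j; rewrite !mxE rmulDl. Qed.

Fact row_actDr a x y : row_act a (x + y) = row_act a x + row_act a y.
Proof. by apply/matrixP=> i j; rewrite !mxE rmulDr. Qed.

HB.instance Definition _ :=
  Zmodule_isRngModule.Build I 'rV[I]_n row_actA row_actDl row_actDr.

End RowModule.

Lemma row_actE (I : rngType) n (a : I) (x : 'rV[I]_n) i j :
  (a **: x) i j = a ** x i j.
Proof. by rewrite mxE. Qed.

Lemma row_full (I : rngType) n : idempotent_rng I -> full_module 'rV[I]_n.
Proof.
move=> idI x.
have /choice[s sE] : forall j, exists s : seq (I * I),
  x 0 j = \sum_(p <- s) p.1 ** p.2 by move=> j; apply: idI.
(* Each product in the decomposition of the entry [x 0 j] becomes a scalar acting on a row supported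
   at [j]. *)
exists [seq (q.1, \row_k if k == j then q.2 else 0) | j <- enum 'I_n, q <- s j].
rewrite big_allpairs_dep /=; apply/rowP=> k; rewrite summxE big_enum /=.
rewrite (bigD1 k) //= [X in _ + X]big1 => [|j /negPf jk].
  by rewrite addr0 summxE sE; apply: eq_bigr => q _; rewrite row_actE mxE eqxx.
rewrite summxE big1 // => q _.
by rewrite row_actE mxE eq_sym jk rmul0r.
Qed.

Lemma rmulmxDl (I : rngType) m n p (A B : 'M[I]_(m, n)) (C : 'M[I]_(n, p)) :
  (A + B) **m C = A **m C + B **m C.
Proof.
apply/matrixP=> i j; rewrite !mxE -big_split /=.
by apply: eq_bigr => k _; rewrite mxE rmulDl.
Qed.

Lemma rmulmxDr (I : rngType) m n p (A : 'M[I]_(m, n)) (B C : 'M[I]_(n, p)) :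
  A **m (B + C) = A **m B + A **m C.
Proof.
apply/matrixP=> i j; rewrite !mxE -big_split /=.
by apply: eq_bigr => k _; rewrite mxE rmulDr.
Qed.

Lemma rmulmxBl (I : rngType) m n p (A B : 'M[I]_(m, n)) (C : 'M[I]_(n, p)) :
  (A - B) **m C = A **m C - B **m C.
Proof. by apply/eqP; rewrite eq_sym subr_eq -rmulmxDl subrK. Qed.

Lemma rmulmxBr (I : rngType) m n p (A : 'M[I]_(m, n)) (B C : 'M[I]_(n, p)) :
  A **m (B - C) = A **m B - A **m C.
Proof. by apply/eqP; rewrite eq_sym subr_eq -rmulmxDr subrK. Qed.

Lemma row_act_mul (I : rngType) n m (a : I) (x : 'rV[I]_n) (A : 'M[I]_(n, m)) :
  a **: (x **m A) = (a **: x) **m A.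
Proof.
apply/matrixP=> i j; rewrite row_actE !mxE rmul_sumr.
by apply: eq_bigr => k _; rewrite row_actE rmulA.
Qed.

(* The product of a matrix with a column of module elements. *)
Definition mxact (I : rngType) (M : rngModType I) m n (A : 'M[I]_(m, n))
    (p : 'I_n -> M) : 'I_m -> M :=
  fun i => \sum_j A i j **: p j.

Section MxAct.
Variables (I : rngType) (M : rngModType I).

Lemma mxactA m n k (A : 'M[I]_(m, n)) (B : 'M[I]_(n, k)) (p : 'I_k -> M) :
  mxact A (mxact B p) = mxact (A **m B) p.
Proof.
apply: funext => i; rewrite /mxact; under eq_bigr do rewrite act_sumr.
rewrite exchange_big; apply: eq_bigr => j _ /=; rewrite mxE act_suml.
by apply: eq_bigr => l _; rewrite actA.
Qed.

Lemma mxactDl m n (A B : 'M[I]_(m, n)) (p : 'I_n -> M) i :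
  mxact (A + B) p i = mxact A p i + mxact B p i.
Proof.
by rewrite /mxact -big_split; apply: eq_bigr => j _; rewrite mxE actDl.
Qed.

Lemma mxactBl m n (A B : 'M[I]_(m, n)) (p : 'I_n -> M) i :
  mxact (A - B) p i = mxact A p i - mxact B p i.
Proof. by apply/eqP; rewrite eq_sym subr_eq -mxactDl subrK. Qed.

Lemma mxactZ n (a : I) (x : 'rV[I]_n) (p : 'I_n -> M) i :
  mxact (a **: x) p i = a **: mxact x p i.
Proof.
by rewrite /mxact act_sumr; apply: eq_bigr => j _; rewrite row_actE actA.
Qed.

Lemma mxact_row m n (A : 'M[I]_(m, n)) (p : 'I_n -> M) i :
  mxact (row i A) p 0 = mxact A p i.
Proof. by apply: eq_bigr => j _; rewrite mxE. Qed.

Lemma mxact_hom (N : rngModType I) (f : modHom M N) m n (A : 'M[I]_(m, n))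
    (p : 'I_n -> M) i : f (mxact A p i) = mxact A (f \o p) i.
Proof. by rewrite raddf_sum; apply: eq_bigr => j _; rewrite /= modHomZ. Qed.

Lemma mxact_modHom n (p : 'I_n -> M) :
  exists f : modHom 'rV[I]_n M, forall x, f x = mxact x p 0.
Proof.
by apply: modHom_of => [x y|a x]; rewrite (mxactDl, mxactZ).
Qed.

End MxAct.

Lemma row_rmulmx (I : rngType) m n k (A : 'M[I]_(m, n)) (B : 'M[I]_(n, k)) i :
  row i (A **m B) = row i A **m B.
Proof.
by apply/rowP=> j; rewrite !mxE; apply: eq_bigr => l _; rewrite mxE.
Qed.

(** Turns an equality modulo elements killed by I into a true equality, at the price of a factor on
    the left. *)
Lemma ann_rmulmx0 (I : rngType) k m n (Z : 'M[I]_(k, m)) (X : 'M[I]_(m, n)) :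
  (forall i a, a **: row i X = 0) -> Z **m X = 0.
Proof.
move=> h; apply/matrixP=> i j; rewrite !mxE big1 // => l _.
by have /rowP/(_ j) := h l (Z i l); rewrite row_actE !mxE.
Qed.

Lemma mxact_rows (I : rngType) m n (x : 'rV[I]_m) (A : 'M[I]_(m, n)) :
  mxact x (fun i => row i A) 0 = x **m A.
Proof.
apply/rowP=> j; rewrite summxE mxE; apply: eq_bigr => i _.
by rewrite row_actE mxE.
Qed.

(* When [e] is idempotent this says that [P] is the quotient of [I^n e] by    *)
(* the elements killed by [I], the [p i] being the images of the rows of [e]. *)
Record presents (I : rngType) (P : rngModType I) n (e : 'M[I]_n)
    (p : 'I_n -> P) : Prop := Presents {
  presents_fix : mxact e p = p;
  presents_span : forall y, exists x : 'rV[I]_n, y = mxact x p 0;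
  presents_ker : forall x : 'rV[I]_n,
    mxact x p 0 = 0 -> forall a, a **: (x **m e) = 0
}.

Definition presented (I : rngType) (e : idempotent_mx I) (P : rngModType I) :=
  exists p, presents (P := P) (tagged (val e)) p.

(** * Modules presented by idempotent matrices *)

Section Presentation.
Variables (I : rngType).

Lemma presents_spans (P : rngModType I) n (e : 'M[I]_n) (p : 'I_n -> P) m
    (q : 'I_m -> P) :
  presents e p -> exists A : 'M[I]_(m, n), q = mxact A p.
Proof.
move=> pe; have /choice[x xE] :
    forall i, exists x : 'rV[I]_n, q i = mxact x p 0.
  by move=> i; apply: (presents_span pe).
exists (\matrix_(i, j) x i 0 j); apply: funext => i; rewrite xE.
by apply: eq_bigr => j _; rewrite mxE.
Qed.

(** Relations among the generators determine a matrix only after multiplication by [e] and modulo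
    elements killed by I; the left factor [Z] removes the latter ambiguity. *)
Lemma presents_eq (P : rngModType I) n (e : 'M[I]_n) (p : 'I_n -> P) k m
    (Z : 'M[I]_(k, m)) (A B : 'M[I]_(m, n)) :
  presents e p -> mxact A p = mxact B p -> Z **m A **m e = Z **m B **m e.
Proof.
move=> pe AB; apply/eqP; rewrite -subr_eq0 -rmulmxBl -rmulmxBr -rmulmxA.
rewrite ann_rmulmx0 // => i a; rewrite row_rmulmx.
by apply: (presents_ker pe); rewrite mxact_row mxactBl AB subrr.
Qed.

Lemma presents_hom_eq (P M : rngModType I) n (e : 'M[I]_n) (p : 'I_n -> P)
    (f g : modHom P M) :
  presents e p -> (forall i, f (p i) = g (p i)) -> f = g.
Proof.
move=> pe fg; apply: modHom_ext => y; have [x ->] := presents_span pe y.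
by rewrite !mxact_hom; congr (mxact x _ _); apply: funext.
Qed.

(** The existence half of Hom(P_e, M) = e M^n; [presents_hom_eq] is the uniqueness half. If [x] is a
    relation among the [p i], then I kills [x **m e], so it kills the value of [x] on [m], which is
    therefore zero in the nondegenerate [M]. *)
Lemma presents_hom (P M : rngModType I) n (e : 'M[I]_n) (p : 'I_n -> P)
    (m : 'I_n -> M) :
  nondegenerate_module M -> presents e p -> mxact e m = m ->
  exists g : modHom P M, forall i, g (p i) = m i.
Proof.
move=> ndM pe em.
have [fp fpE] := mxact_modHom p; have [fm fmE] := mxact_modHom m.
have [y|x|g gE] := modHom_factor (p := fp) (f := fm).
- by have [x ->] := presents_span pe y; exists x.
- rewrite fpE fmE => px; apply: ndM => a.
  by rewrite -em mxactA -mxactZ (presents_ker pe px) -fmE raddf0.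
exists g => i; rewrite -[in LHS](presents_fix pe) -mxact_row -fpE gE fmE.
by rewrite mxact_row em.
Qed.

(** If e = AB and f = BA, the column B p is a new system of generators of the same module. The
    relations transfer because f = B e A. *)
Lemma presented_equiv (e f : idempotent_mx I) (P : rngModType I) :
  presented e P -> idem_equiv (val e) (val f) -> presented f P.
Proof.
have ee := idempotent_mxP e; have ff := idempotent_mxP f.
case=> p pe /(idem_equivP ee ff)[A [B []]]; rewrite /presented.
move: (tagged (val e)) (tagged (val f)) A B ee ff p pe.
move=> E F A B ee ff p pe AB BA.
have FE : F = B **m E **m A by rewrite -[LHS]ff -BA -AB !rmulmxA.
exists (mxact B p); split=> [|y|x].
- by rewrite mxactA -BA -rmulmxA AB -mxactA (presents_fix pe).
- have [x ->] := presents_span pe y; exists (x **m A).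
  by rewrite mxactA -rmulmxA AB -mxactA (presents_fix pe).
- rewrite mxactA => /(presents_ker pe) h a.
  by rewrite FE !rmulmxA row_act_mul h rmul0mx.
Qed.

(** Let A and B be the changes of generators, q = A p and p = B q. The matrices e B f and f A e
    realize the equivalence: B f A fixes p just as e does, so [presents_eq] gives e (B f A) e = e,
    and symmetrically for f. *)
Lemma presented_uniq (e f : idempotent_mx I) (P : rngModType I) :
  presented e P -> presented f P -> idem_equiv (val e) (val f).
Proof.
have ee := idempotent_mxP e; have ff := idempotent_mxP f.
move=> [p pe] [q qf]; apply/(idem_equivP ee ff).
have [A qA] := presents_spans q pe; have [B pB] := presents_spans p qf.
move: (tagged (val e)) (tagged (val f)) ee ff p pe q qf A qA B pB.
move=> E F ee ff p pe q qf A qA B pB.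
exists (E **m B **m F), (F **m A **m E); split.
  have -> : E **m B **m F **m (F **m A **m E) = E **m (B **m F **m A) **m E.
    by rewrite !rmulmxA -(rmulmxA (E **m B)) ff.
  rewrite (presents_eq (B := E) E pe) ?ee //.
  by rewrite -!mxactA -qA (presents_fix qf) -pB (presents_fix pe).
have -> : F **m A **m E **m (E **m B **m F) = F **m (A **m E **m B) **m F.
  by rewrite !rmulmxA -(rmulmxA (F **m A)) ee.
rewrite (presents_eq (B := F) F qf) ?ff //.
by rewrite -!mxactA -pB (presents_fix pe) -qA (presents_fix qf).
Qed.

Lemma presents_iso (P Q : rngModType I) n (e : 'M[I]_n) (p : 'I_n -> P)
    (f : modHom P Q) (g : modHom Q P) :
  cancel f g -> cancel g f -> presents e p -> presents e (f \o p).
Proof.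
move=> fK gK pe; split=> [|y|x px].
- by apply: funext => i; rewrite -mxact_hom (presents_fix pe).
- have [x gy] := presents_span pe (g y).
  by exists x; rewrite -mxact_hom -gy gK.
- apply: (presents_ker pe).
  by rewrite -[LHS]fK mxact_hom px raddf0.
Qed.

(** The module is built as a quotient of I^n, which is full, by the rows [x] such that I kills
    [x **m E]. Since [E] is idempotent, [x] and [x **m E] have the same image, so the images of the
    rows of [E] generate. *)
Lemma presented_exists (e : idempotent_mx I) :
  idempotent_rng I -> exists P : fullNondegMod I, presented e P.
Proof.
move=> idI; have := idempotent_mxP e; rewrite /presented.
case: (val e) => n E /= ee.
have [||||Q [q [surj ker]]] := @quotient_module I 'rV[I]_n
    (fun x => forall a, a **: (x **m E) = 0) (row_full (n := n) idI).
- by move=> a; rewrite rmul0mx acts0.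
- by move=> x y hx hy a; rewrite rmulmxBl actDr actN hx hy subrr.
- by move=> a x h b; rewrite -row_act_mul h acts0.
- move=> x h; apply: idempotent_ann => // a b.
  by rewrite [b **: _]row_act_mul.
have qE (x : 'rV_n) : mxact x (fun i => q (row i E)) 0 = q x.
  rewrite -mxact_hom mxact_rows; apply/eqP; rewrite -subr_eq0 -raddfB.
  by apply/eqP/ker => a; rewrite rmulmxBl -rmulmxA ee subrr acts0.
exists Q, (fun i => q (row i E)); split=> [|y|x].
- by apply: funext => i; rewrite -mxact_row qE.
- by have [x ->] := surj y; exists x; rewrite qE.
- by rewrite qE => /ker.
Qed.

End Presentation.

(** * Categorical notions preserved by equivalences *)

(** Serves to choose families of arrows, whose types vary with the index. *)
Lemma dep_choice (A : Type) (B : A -> Type) (R : forall a, B a -> Prop) :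
  (forall a, exists b, R a b) -> exists f : forall a, B a, forall a, R a (f a).
Proof.
by move=> h; exists (fun a => projT1 (cid (h a))) => a; case: (cid (h a)).
Qed.

Definition isomorphic (C : category) (X Y : C) : Prop :=
  exists (f : hom X Y) (g : hom Y X), comp g f = idm X /\ comp f g = idm Y.

Definition jointly_epi (C : category) (A : Type) (X : A -> C) (Y : C)
    (f : forall a, hom (X a) Y) : Prop :=
  forall (Z : C) (g h : hom Y Z),
    (forall a, comp g (f a) = comp h (f a)) -> g = h.

(** Stated as a one-member family so that [jointly_epi_span] covers single epimorphisms too. *)
Definition epi (C : category) (X Y : C) (f : hom X Y) : Prop :=
  jointly_epi (fun _ : unit => f).

Definition projective (C : category) (P : C) : Prop :=
  forall (X Y : C) (q : hom X Y), epi q ->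
  forall f : hom P Y, exists g, comp q g = f.

Definition compact (C : category) (P : C) : Prop :=
  forall (A : Type) (X : A -> C) (f : forall a, hom (X a) P), jointly_epi f ->
  exists n (i : 'I_n -> A), jointly_epi (fun k => f (i k)).

Definition is_coproduct (C : category) (P Q S : C) (i : hom P S) (j : hom Q S) :
    Prop :=
  (forall (Z : C) (u : hom P Z) (v : hom Q Z),
     exists w, comp w i = u /\ comp w j = v) /\
  (forall (Z : C) (w w' : hom S Z),
     comp w i = comp w' i -> comp w j = comp w' j -> w = w').

(** The form in which equivalences are used below: objects of [D] are replaced by images under [F],
    and arrows between images are lifted to [C]. *)
Record is_equivalence (C D : category) (F : functor C D) : Prop :=
  IsEquivalence {
    faithful : forall (X Y : C) (f g : hom X Y), fmor F f = fmor F g -> f = g;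
    full : forall (X Y : C) (h : hom (F X) (F Y)), exists f, fmor F f = h;
    ess_surj : forall Y : D, exists X : C, isomorphic (F X) Y
  }.

Lemma coproduct_uniq (C : category) (P Q S S' : C) (i : hom P S) (j : hom Q S)
    (i' : hom P S') (j' : hom Q S') :
  is_coproduct i j -> is_coproduct i' j' -> isomorphic S S'.
Proof.
move=> [ex un] [ex' un'].
have [f [fi fj]] := ex _ i' j'; have [g [gi gj]] := ex' _ i j.
exists f, g; split.
  by apply: un; rewrite -compA ?fi ?fj ?gi ?gj comp_idl.
by apply: un'; rewrite -compA ?gi ?gj ?fi ?fj comp_idl.
Qed.

(** Naturality recovers [f] as the conjugate of [fmor H f] by the isomorphism. *)
Lemma naturally_isomorphic_id_faithful (C : category) (H : functor C C) :
  naturally_isomorphic H (functor_id C) ->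
  forall (X Y : C) (f g : hom X Y), fmor H f = fmor H g -> f = g.
Proof.
move=> [eta [eps [nat _ etaK]]] X Y f g Hfg.
rewrite -[f]comp_idr -(etaK X) compA -(nat _ _ f) Hfg nat.
by rewrite -compA (etaK X) comp_idr.
Qed.

Lemma is_equivalence_of (C D : category) (F : functor C D) (G : functor D C) :
  naturally_isomorphic (functor_comp G F) (functor_id C) ->
  naturally_isomorphic (functor_comp F G) (functor_id D) ->
  is_equivalence F.
Proof.
move=> GF FG; split.
- move=> X Y f g Ffg; apply: (naturally_isomorphic_id_faithful GF).
  by rewrite /= Ffg.
- case: (GF) => eta [eps [nat epsK etaK]] X Y h.
  (* Conjugating G h by the isomorphism of GF with the identity gives an arrow k from X to Y. By
     naturality G (F k) = G h, and G is faithful. *)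
  exists (comp (eta Y) (comp (fmor G h) (eps X))).
  have G_faithful (A B : D) (u v : hom A B) : fmor G u = fmor G v -> u = v.
    by move=> Guv; apply: (naturally_isomorphic_id_faithful FG); rewrite /= Guv.
  apply: G_faithful; set k := comp (eta Y) _.
  have := nat _ _ k; rewrite /= => nk.
  rewrite -[LHS]comp_idl -(epsK Y) -compA [X in comp _ X]nk /k.
  by rewrite -!compA (epsK X) comp_idr compA (epsK Y) comp_idl.
- case: FG => eta [eps [_ epsK etaK]] Y.
  by exists (G Y), (eta Y), (eps Y); split; [apply: epsK | apply: etaK].
Qed.

Section Equivalence.
Variables (C D : category) (F : functor C D).
Hypothesis eqvF : is_equivalence F.

Lemma equivalence_reflects_iso (X Y : C) :
  isomorphic (F X) (F Y) -> isomorphic X Y.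
Proof.
case=> f [g [gf fg]].
have [f' f'E] := full eqvF f; have [g' g'E] := full eqvF g.
exists f', g'.
by split; apply: (faithful eqvF); rewrite fmor_comp f'E g'E fmor_id.
Qed.

Lemma equivalence_jointly_epi (A : Type) (X : A -> C) (Y : C)
    (f : forall a, hom (X a) Y) :
  jointly_epi (fun a => fmor F (f a)) <-> jointly_epi f.
Proof.
split=> epi_f Z g h gh.
  apply: (faithful eqvF); apply: epi_f => a.
  by rewrite -!fmor_comp gh.
(* The test object is moved into the image of [F], where the two arrows to be compared can be
   lifted. *)
have [Z' [i [j [ji ij]]]] := ess_surj eqvF Z.
have [g' g'E] := full eqvF (comp j g); have [h' h'E] := full eqvF (comp j h).
have gh' : g' = h'.
  apply: epi_f => a; apply: (faithful eqvF).
  by rewrite !fmor_comp g'E h'E -!compA gh.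
by rewrite -[g]comp_idl -[h]comp_idl -ij -!compA -g'E -h'E gh'.
Qed.

(** Each [i a] is a split epimorphism and can be cancelled. This lets the sources of a family be
    replaced by objects in the image of [F]. *)
Lemma jointly_epi_comp_iso (A : Type) (X X' : A -> D) (Y : D)
    (f : forall a, hom (X a) Y) (i : forall a, hom (X' a) (X a))
    (j : forall a, hom (X a) (X' a)) :
  (forall a, comp (i a) (j a) = idm (X a)) ->
  jointly_epi f <-> jointly_epi (fun a => comp (f a) (i a)).
Proof.
move=> ij; split=> epi_f Z g h gh; apply: epi_f => a; last by rewrite !compA gh.
by rewrite -[f a]comp_idr -ij !(compA (f a)) (compA g) (compA h) gh.
Qed.

Lemma equivalence_projective (P : C) : projective P -> projective (F P).
Proof.
move=> projP X Y q epi_q f.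
have [X' [i [j [ji ij]]]] := ess_surj eqvF X.
have [Y' [k [l [lk kl]]]] := ess_surj eqvF Y.
have [q' q'E] := full eqvF (comp l (comp q i)).
have [f' f'E] := full eqvF (comp l f).
have epi_q' : epi q'.
  move=> Z g h gh; apply: (faithful eqvF).
  have gh' : comp (fmor F g) l = comp (fmor F h) l.
    apply: epi_q => _; rewrite -[q]comp_idr -ij (compA q).
    have := congr1 (fmor F) (gh tt).
    by rewrite !fmor_comp q'E !compA => ->.
  by rewrite -[LHS]comp_idr -[RHS]comp_idr -lk !compA gh'.
have [g gE] := projP _ _ q' epi_q' f'.
exists (comp i (fmor F g)).
rewrite -[f]comp_idl -kl -compA -f'E -gE fmor_comp q'E.
by rewrite !compA kl comp_idl.
Qed.

Lemma equivalence_compact (P : C) : compact P -> compact (F P).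
Proof.
move=> cP A X f epi_f.
have /choice[X' X'E] := fun a => ess_surj eqvF (X a).
have /dep_choice[i /dep_choice[j ij]] : forall a, exists i j,
  comp j i = idm (F (X' a)) /\ comp i j = idm (X a) by exact: X'E.
have /dep_choice[f' f'E] := fun a => full eqvF (comp (f a) (i a)).
have Ff' : (fun a => fmor F (f' a)) = (fun a => comp (f a) (i a)).
  exact: functional_extensionality_dep.
have ijK a := (ij a).2.
have [|n [k epi_k]] := cP A X' f'.
  apply/equivalence_jointly_epi; rewrite Ff'.
  exact/(jointly_epi_comp_iso f ijK).
exists n, k.
apply/(jointly_epi_comp_iso (fun m => f (k m)) (fun m => ijK (k m))).
have -> : (fun m => comp (f (k m)) (i (k m))) = (fun m => fmor F (f' (k m))).
  by apply: functional_extensionality_dep => m; rewrite f'E.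
exact/(equivalence_jointly_epi (fun m => f' (k m))).
Qed.

Lemma equivalence_coproduct (P Q S : C) (i : hom P S) (j : hom Q S) :
  is_coproduct i j -> is_coproduct (fmor F i) (fmor F j).
Proof.
move=> [ex un]; split.
  move=> Z u v; have [Z' [k [l [lk kl]]]] := ess_surj eqvF Z.
  have [u' u'E] := full eqvF (comp l u); have [v' v'E] := full eqvF (comp l v).
  have [w [wi wj]] := ex _ u' v'.
  exists (comp k (fmor F w)).
  by rewrite -!compA -!fmor_comp wi wj u'E v'E !compA kl !comp_idl.
move=> Z w w' wi wj; have [Z' [k [l [lk kl]]]] := ess_surj eqvF Z.
have [u uE] := full eqvF (comp l w); have [v vE] := full eqvF (comp l w').
rewrite -[w]comp_idl -[w']comp_idl -kl -!compA -uE -vE.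
congr (comp _ (fmor F _)).
by apply: un; apply: (faithful eqvF); rewrite !fmor_comp uE vE -!compA ?wi ?wj.
Qed.

End Equivalence.

(** * Compact projective objects of [I-Mod] *)

Section ModuleCategory.
Variable I : rngType.
Hypothesis idI : idempotent_rng I.

Lemma isomorphic_cancel (P Q : ModCat I) :
  isomorphic P Q ->
  exists (f : modHom (fnm_mod P) (fnm_mod Q))
         (g : modHom (fnm_mod Q) (fnm_mod P)),
    cancel f g /\ cancel g f.
Proof.
case=> f [g [gf fg]]; exists f, g; split=> x.
  exact: (congr1 (fun h : modHom _ _ => h x) gf).
exact: (congr1 (fun h : modHom _ _ => h x) fg).
Qed.

Lemma presented_isomorphic (e : idempotent_mx I) (P Q : ModCat I) :
  isomorphic P Q -> presented e (fnm_mod P) -> presented e (fnm_mod Q).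
Proof.
move=> /isomorphic_cancel[f [g [fK gK]]] [p pe]; exists (f \o p).
exact: presents_iso fK gK pe.
Qed.

Lemma isomorphic_presented (e : idempotent_mx I) (P Q : ModCat I) :
  presented e (fnm_mod P) -> presented e (fnm_mod Q) -> isomorphic P Q.
Proof.
move=> [p pe] [q qe].
have [f fE] := presents_hom (@fnm_nondeg _ Q) pe (presents_fix qe).
have [g gE] := presents_hom (@fnm_nondeg _ P) qe (presents_fix pe).
exists f, g; split.
  by apply: (presents_hom_eq pe) => i; rewrite /= fE gE.
by apply: (presents_hom_eq qe) => i; rewrite /= gE fE.
Qed.

(** Compare the projection onto the quotient by the elements that I sends into the span with the
    zero morphism. Both vanish on the family, so they agree; hence I P lies in the span, and I P = P
    because [P] is full. *)
Lemma jointly_epi_span (A : Type) (X : A -> ModCat I) (P : ModCat I)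
    (f : forall a, modHom (fnm_mod (X a)) (fnm_mod P)) :
  jointly_epi (C := ModCat I) f ->
  forall y : fnm_mod P, exists s : seq {a : A & fnm_mod (X a)},
    y = \sum_(u <- s) f (tag u) (tagged u).
Proof.
move=> epi_f.
pose S0 (y : fnm_mod P) := exists s : seq {a : A & fnm_mod (X a)},
    y = \sum_(u <- s) f (tag u) (tagged u).
have S00 : S0 0 by exists [::]; rewrite big_nil.
have S0D x y : S0 x -> S0 y -> S0 (x + y).
  by move=> [s ->] [t ->]; exists (s ++ t); rewrite big_cat.
have S0Z a x : S0 x -> S0 (a **: x).
  move=> [s ->].
  exists [seq existT (fun a => fnm_mod (X a)) (tag u) (a **: tagged u)
         | u <- s].
  by rewrite act_sumr big_map; apply: eq_bigr => u _; rewrite /= modHomZ.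
have S0N x : S0 x -> S0 (- x).
  move=> [s ->].
  exists [seq existT (fun a => fnm_mod (X a)) (tag u) (- tagged u) | u <- s].
  by rewrite -sumrN big_map; apply: eq_bigr => u _; rewrite /= raddfN.
have S0sum (T : Type) (r : seq T) (G : T -> fnm_mod P) :
    (forall i, S0 (G i)) -> S0 (\sum_(i <- r) G i).
  by move=> S0G; apply: (big_ind S0).
(* The cokernel of the family, made nondegenerate, is zero. *)
have [||||Q [p [_ ker]]] := @quotient_module I (fnm_mod P)
    (fun x => forall a, S0 (a **: x)) (@fnm_full _ P).
- by move=> a; rewrite acts0.
- by move=> x y Sx Sy a; rewrite actDr actN; apply: S0D => //; apply: S0N.
- by move=> a x Sx b; rewrite actA.
(* Saturation: [c] is a sum of products, so it sends [x] into the span as soon as all products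
   do. *)
- move=> x Sx c; have [s ->] := idI c; rewrite act_suml.
  by apply: S0sum => q; rewrite -actA; apply: Sx.
have [x y|a x|z zE] := @modHom_of I (fnm_mod P) (fnm_mod Q) (fun=> 0).
- by rewrite addr0.
- by rewrite acts0.
have pz : p = z.
  apply: (epi_f Q p z) => a; apply: modHom_ext => x /=.
  rewrite zE; apply/ker => b.
  exists [:: existT (fun a => fnm_mod (X a)) a (b **: x)].
  by rewrite big_seq1 modHomZ.
move=> y; have [s ->] := @fnm_full _ P y; apply: S0sum => q.
by have := zE q.2; rewrite -pz => /ker.
Qed.

Lemma presented_projective (e : idempotent_mx I) (P : ModCat I) :
  presented e (fnm_mod P) -> projective P.
Proof.
move=> [p pe] X Y q epi_q f.
have surj (y : fnm_mod Y) : exists x, q x = y.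
  have [s ->] := jointly_epi_span epi_q y.
  by exists (\sum_(u <- s) tagged u); rewrite raddf_sum.
have /choice[x xE] := fun i => surj (f (p i)).
(* The chosen preimages [x] need not form a column fixed by the idempotent. Multiplying by the
   idempotent corrects this, and the result still lies above the column of the [f (p i)], which is
   fixed. *)
have [|g gE] :=
    presents_hom (m := mxact (tagged (val e)) x) (@fnm_nondeg _ X) pe.
  by rewrite mxactA idempotent_mxP.
exists g; apply: (presents_hom_eq pe) => i /=.
rewrite gE mxact_hom -[in RHS](presents_fix pe) mxact_hom.
by congr (mxact _ _ i); apply: funext => j; rewrite /= xE.
Qed.

Lemma presented_compact (e : idempotent_mx I) (P : ModCat I) :
  presented e (fnm_mod P) -> compact P.
Proof.
move=> [p pe] A X f epi_f.
have /choice[s sE] := fun i => jointly_epi_span epi_f (p i).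
(* [T] indexes all summands in the chosen expressions of the finitely many generators; the members
   of the family occurring there suffice. *)
pose T : finType := {i : 'I_(tag (val e)) & 'I_(size (s i))}.
pose F (t : T) := tnth (in_tuple (s (tag t))) (tagged t).
exists #|T|, (fun k => tag (F (enum_val k))) => Z g h gh.
apply: (presents_hom_eq pe) => i; rewrite sE big_tnth !raddf_sum.
apply: eq_bigr => l _; pose t : T := existT (fun i => 'I_(size (s i))) i l.
have := gh (enum_rank t); rewrite enum_rankK.
by move/(congr1 (fun k : modHom _ _ => k (tagged (F t)))).
Qed.

(** Compactness yields finitely many generators and so an epimorphism onto [P] from I^n modulo the
    elements killed by I; projectivity splits it, and the resulting idempotent endomorphism is
    described by a matrix. *)
Lemma compact_projective_presented (P : ModCat I) :
  compact P -> projective P ->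
  exists e : idempotent_mx I, presented e (fnm_mod P).
Proof.
move=> cP projP.
have /choice[Fr /dep_choice[q qP]] :=
    fun n => ann_quotient idI (row_full (n := n) idI).
have q_surj n := (qP n).1; have q_ker n := (qP n).2.
have lift n (p : 'I_n -> fnm_mod P) : exists f : modHom (Fr n) (fnm_mod P),
    forall x, f (q n x) = mxact x p 0.
  have [f fE] := mxact_modHom p.
  have [x /q_ker qx|g gE] := modHom_factor (p := q n) (f := f) (@q_surj n).
    by apply: (@fnm_nondeg _ P) => a; rewrite -modHomZ qx raddf0.
  by exists g => x; rewrite gE fE.
(* [f y] sends the class of a scalar [a] to [a **: y]. Over all [y] these arrows are jointly
   epimorphic because [P] is full. *)
have /dep_choice[f fE] := fun y => lift 1%N (fun=> y).
have [|n [p epi_p]] := cP (fnm_mod P) (fun=> Fr 1%N) f.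
  move=> Z g h gh; apply: modHom_ext => y.
  have [s ->] := @fnm_full _ P y; rewrite !raddf_sum; apply: eq_bigr => u _.
  have := congr1 (fun k : modHom _ _ => k (q 1%N (const_mx u.1))) (gh u.2).
  by rewrite /= fE /mxact big_ord1 mxE.
have [pi piE] := lift n p.
have epi_pi : epi (C := ModCat I) (X := Fr n) (Y := P) pi.
  move=> Z g h gh; apply: epi_p => k; apply: modHom_ext => z.
  have [x ->] := q_surj _ z.
  pose y : 'rV[I]_n := \row_j if j == k then x 0 0 else 0.
  have yE : f (p k) (q 1%N x) = pi (q n y).
    rewrite fE piE /mxact big_ord1 (bigD1 k) //= mxE eqxx big1 ?addr0 //.
    by move=> j /negPf jk; rewrite mxE jk act0s.
  rewrite /= yE.
  exact: (congr1 (fun k : modHom _ _ => k (q n y)) (gh tt)).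
have [s sE] := projP _ _ _ epi_pi (modHom_id (fnm_mod P)).
have sK y : pi (s y) = y.
  exact: (congr1 (fun k : modHom _ _ => k y) sE).
have /choice[x xE] := fun i => q_surj n (s (p i)).
(* The rows of [E] represent the elements [s (p i)], so the endomorphism [s] after [pi] is right
   multiplication by [E] on classes. *)
pose E := \matrix_(i, j) x i 0 j.
have rowE i : row i E = x i by apply/rowP=> j; rewrite !mxE.
have Ep : mxact E p = p.
  by apply: funext => i; rewrite -mxact_row rowE -piE -xE sK.
have s_mx (y : 'rV[I]_n) : s (mxact y p 0) = q n (y **m E).
  rewrite mxact_hom -mxact_rows mxact_hom; congr (mxact y _ 0).
  by apply: funext => i /=; rewrite rowE xE.
have EE m (Z : 'M[I]_(m, n)) : Z **m (E **m E) = Z **m E.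
  apply/eqP; rewrite -subr_eq0 -rmulmxBr; apply/eqP/ann_rmulmx0 => i.
  apply/q_ker; have -> : row i (E **m E - E) = row i (E **m E) - row i E.
    by apply/rowP=> j; rewrite !mxE.
  rewrite raddfB row_rmulmx -s_mx mxact_row Ep.
  by rewrite rowE xE subrr.
(* [E] is idempotent only modulo the elements killed by [I]; [E **m E] is an
   idempotent lift. *)
have idEE : tagged (Minf (E **m E)) **m tagged (Minf (E **m E)) =
    tagged (Minf (E **m E)).
  by rewrite /= EE -rmulmxA EE.
pose e : idempotent_mx I :=
  Sub (Minf (E **m E)) (asboolT (idempotent_mxI idEE)).
exists e, p; split=> /= [|y|y py a].
- by rewrite -mxactA !Ep.
- by have [z zE] := q_surj n (s y); exists z; rewrite -piE -zE sK.
- have /q_ker yE : q n (y **m E) = 0 by rewrite -s_mx py raddf0.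
  by rewrite rmulmxA row_act_mul yE rmul0mx.
Qed.

Lemma mxact_block_diag (M : rngModType I) m n (A : 'M[I]_m) (B : 'M[I]_n)
    (u : 'I_(m + n) -> M) :
  (forall i, mxact (block_mx A 0 0 B) u (lshift n i) =
             mxact A (u \o @lshift m n) i) /\
  (forall i, mxact (block_mx A 0 0 B) u (rshift m i) =
             mxact B (u \o @rshift m n) i).
Proof.
split=> i; rewrite /mxact big_split_ord /=.
  rewrite [X in _ + X]big1 => [|j _]; last by rewrite block_mxEur mxE act0s.
  by rewrite addr0; apply: eq_bigr => j _; rewrite block_mxEul.
rewrite [X in X + _]big1 => [|j _]; last by rewrite block_mxEdl mxE act0s.
by rewrite add0r; apply: eq_bigr => j _; rewrite block_mxEdr.
Qed.

(** An arrow out of [S] is a column fixed by the block matrix, that is, a column fixed by [A] on top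
    of one fixed by [B], that is, a pair of arrows out of [P] and [Q]. *)
Lemma presents_dsum (P Q S : ModCat I) m n (A : 'M[I]_m) (B : 'M[I]_n)
    (p : 'I_m -> fnm_mod P) (q : 'I_n -> fnm_mod Q)
    (r : 'I_(m + n) -> fnm_mod S) :
  presents A p -> presents B q -> presents (block_mx A 0 0 B) r ->
  exists (i : hom P S) (j : hom Q S), is_coproduct i j.
Proof.
move=> pA qB rAB; have [rl rr] := mxact_block_diag A B r.
rewrite (presents_fix rAB) in rl rr.
have [|i iE] := presents_hom (m := r \o @lshift m n) (@fnm_nondeg _ S) pA.
  by apply: funext => k; rewrite -rl.
have [|j jE] := presents_hom (m := r \o @rshift m n) (@fnm_nondeg _ S) qB.
  by apply: funext => k; rewrite -rr.
exists i, j; split=> [Z u v|Z w w' wi wj].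
  pose t k := match split k with inl a => u (p a) | inr b => v (q b) end.
  have tl a : t (lshift n a) = u (p a) by rewrite /t (unsplitK (inl a)).
  have tr b : t (rshift m b) = v (q b) by rewrite /t (unsplitK (inr b)).
  have [|w wE] := presents_hom (m := t) (@fnm_nondeg _ Z) rAB.
    apply: funext => k; have [ul ur] := mxact_block_diag A B t.
    case: (split_ordP k) => [a ->|b ->].
      rewrite ul tl -[in RHS](presents_fix pA) mxact_hom.
      by congr (mxact A _ a); apply: funext => c /=.
    rewrite ur tr -[in RHS](presents_fix qB) mxact_hom.
    by congr (mxact B _ b); apply: funext => c /=.
  exists w; split.
    by apply: (presents_hom_eq pA) => a; rewrite /= iE wE /= tl.
  by apply: (presents_hom_eq qB) => b; rewrite /= jE wE /= tr.
apply: (presents_hom_eq rAB) => k; case: (split_ordP k) => [a ->|b ->].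
  have := congr1 (fun h : modHom _ _ => h (p a)) wi.
  by rewrite /= iE.
have := congr1 (fun h : modHom _ _ => h (q b)) wj.
by rewrite /= jE.
Qed.

End ModuleCategory.

(** * The isomorphism between V(I) and V(J) *)

Lemma functor_isomorphic (C D : category) (F : functor C D) (X Y : C) :
  isomorphic X Y -> isomorphic (F X) (F Y).
Proof.
case=> f [g [gf fg]]; exists (fmor F f), (fmor F g).
by rewrite -!fmor_comp gf fg !fmor_id.
Qed.

Theorem corollary5p6 (I J : rngType) :
  idempotent_rng I -> idempotent_rng J -> morita_equivalent I J ->
  exists phi : {additive V I -> V J}, bijective phi.
Proof.
move=> idI idJ [F [G [GF FG]]].
have eqvF := is_equivalence_of GF FG; have eqvG := is_equivalence_of FG GF.
have presF (e : idempotent_mx I) (P : ModCat I) : presented e (fnm_mod P) ->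
    exists f : idempotent_mx J, presented f (fnm_mod (F P)).
  move=> eP; apply: (compact_projective_presented idJ).
    exact: (equivalence_compact eqvF (presented_compact idI eP)).
  exact: (equivalence_projective eqvF (presented_projective idI eP)).
have /choice[phi phiP] : forall x : V I, exists y : V J, exists P : ModCat I,
    presented (repr x) (fnm_mod P) /\ presented (repr y) (fnm_mod (F P)).
  move=> x; have [P eP] := presented_exists (repr x) idI.
  have [f fP] := presF _ P eP; exists (Vclass f), P; split=> //.
  exact: (presented_equiv fP (idem_equiv_sym (Vclass_repr f))).
(* The value of [phi] does not depend on the chosen representatives and modules. *)
have phiE (e : idempotent_mx I) (f : idempotent_mx J) (P : ModCat I) :
    presented e (fnm_mod P) -> presented f (fnm_mod (F P)) ->
    phi (Vclass e) = Vclass f.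
  move=> eP fP; have [Q [eQ fQ]] := phiP (Vclass e).
  rewrite -[LHS]VclassK; apply/VclassP; apply: (presented_uniq fQ).
  apply: presented_isomorphic fP; apply: functor_isomorphic.
  exact: (isomorphic_presented eP (presented_equiv eQ (Vclass_repr e))).
have phiD x y : phi (x + y) = phi x + phi y.
  have [P [xP yP]] := phiP x; have [Q [xQ yQ]] := phiP y.
  have [S eS] := presented_exists (idem_dsum (repr x) (repr y)) idI.
  have [T fT] := presented_exists (idem_dsum (repr (phi x)) (repr (phi y))) idJ.
  (* [T] and [F S] are both coproducts of [F P] and [F Q], hence isomorphic. *)
  apply: (phiE _ _ S eS); apply: (presented_isomorphic _ fT).
  case: xP xQ eS => p pP [q qQ] [s sS].
  have [i [j /(equivalence_coproduct eqvF) coS]] :=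
    presents_dsum (S := S) pP qQ sS.
  case: yP yQ fT => p' pP' [q' qQ'] [t tT].
  have [i' [j' coT]] := presents_dsum (S := T) pP' qQ' tT.
  exact: coproduct_uniq coT coS.
have phi_inj : injective phi.
  move=> x y xy; have [P [xP yP]] := phiP x; have [Q [xQ yQ]] := phiP y.
  rewrite -[x]VclassK -[y]VclassK; apply/VclassP.
  apply: (presented_uniq xP); apply: presented_isomorphic xQ.
  apply: (equivalence_reflects_iso eqvF); apply: isomorphic_presented yQ _.
  by rewrite -xy.
have phi_surj y : exists x, phi x = y.
  have [Q yQ] := presented_exists (repr y) idJ.
  have [e eP] : exists e : idempotent_mx I, presented e (fnm_mod (G Q)).
    apply: (compact_projective_presented idI).
      exact: (equivalence_compact eqvG (presented_compact (P := Q) idJ yQ)).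
    exact: (equivalence_projective eqvG (presented_projective (P := Q) idJ yQ)).
  (* The preimage is the class of an idempotent presenting [G Q], as [F (G Q)] is isomorphic to
     [Q]. *)
  exists (Vclass e); rewrite -[RHS]VclassK; apply: (phiE _ _ (G Q) eP).
  apply: presented_isomorphic yQ; case: FG => eta [eps [_ epsK etaK]].
  by exists (eps Q), (eta Q); split; [apply: etaK | apply: epsK].
(* Additivity alone does not give this in a monoid without cancellation; a preimage [z] of 0 does,
   since phi(0 + z) = phi(0) + 0. *)
have phi0 : phi 0 = 0.
  by have [z z0] := phi_surj 0; rewrite -z0 -[in RHS](add0r z) phiD z0 addr0.
pose Phi : {additive V I -> V J} :=
  HB.pack phi (GRing.isNmodMorphism.Build (V I) (V J) phi (conj phi0 phiD)).
exists Phi; have /choice[psi psiK] := phi_surj.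
by exists psi => x; [apply: phi_inj; rewrite psiK | apply: psiK].
Qed.
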